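(* Let $R\ge 3$ be an odd integer and, for each positive integer $N$, let $\alpha=\alpha^{(N)}:=[0;\overline{R,NR}]^-$, i.e. the number in $(0,1)$ whose negative continued fraction partial quotients are $a_{2j-1}=R$, $a_{2j}=NR$ for all $j\ge1$. Let $\alpha_0=\alpha$ and $\alpha_{n}$ ($n\ge1$) be the associated sequence from the negative continued fraction algorithm, set $D_{i-1}:=\alpha_0\alpha_1\cdots\alpha_{i-1}$, and define $$\gamma_*=\gamma_*^{(N)}:=\sum_{i=1}^{\infty}\frac12\,(a_i-2+t_i)\,D_{i-1},\qquad t_{2j-1}=-1,\ t_{2j}=N\ (j\ge1).$$ Then $$\lim_{N\to\infty} M\big(\alpha^{(N)},\gamma_*^{(N)}\big)=C(R):=\frac14\left(1-\frac1R\right)\left(1-\frac1{R^2}\right).$$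
   Context: For real $x$, $\|x\|$ denotes the distance from $x$ to the nearest integer. For irrational $\alpha$ and real $\gamma$, $M(\alpha,\gamma):=\liminf_{|n|\to\infty}|n|\,\|n\alpha-\gamma\|$ (over integers $n$). The negative (''round-up'') continued fraction algorithm for $\alpha\in(0,1)$ irrational is $\alpha_0:=\alpha$, $a_{n+1}:=\lceil 1/\alpha_n\rceil$, $\alpha_{n+1}:=\lceil 1/\alpha_n\rceil-1/\alpha_n$, and one writes $\alpha=[0;a_1,a_2,\ldots]^-=\cfrac{1}{a_1-\cfrac{1}{a_2-\cdots}}$; the bar denotes a periodically repeated block. *)

(* Defs.v *)
From HB Require Import structures.
From mathcomp Require Import all_boot all_order all_algebra.
From mathcomp Require Import all_classical all_reals all_analysis.

Set Implicit Arguments.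
Unset Strict Implicit.
Unset Printing Implicit Defensive.

Import Order.TTheory GRing.Theory Num.Theory.
Import numFieldNormedType.Exports.

Local Open Scope classical_set_scope.
Local Open Scope ring_scope.

Definition dist_int (K : realType) (x : K) : K :=
  inf [set `|x - m%:~R| | m in [set: int]].

(* The liminf over the integers as |n| -> +oo (both signs together), written
   out because int carries no filteredType structure for limf_einf; it is
   \bar K-valued, so that it is always meaningful. *)
Definition inhom_liminf (K : realType) (alpha gamma : K) : \bar K :=
  ereal_sup [set ereal_inf
      [set (`|n|%:~R * dist_int (n%:~R * alpha - gamma))%:E
        | n in [set n : int | (m <= `|n|)%N]]
    | m in [set: nat]].

Definition ncf_step (K : realType) (x : K) : K :=
  (Num.ceil x^-1)%:~R - x^-1.

Definition ncf_rem (K : realType) (alpha : K) (n : nat) : K :=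
  iter n (@ncf_step K) alpha.

(* Partial quotients are numbered from 1: a_i = ceil (1 / alpha_{i-1}); the
   value at i = 0 is never used. *)
Definition ncf_quot (K : realType) (alpha : K) (i : nat) : int :=
  Num.ceil (ncf_rem alpha i.-1)^-1.

(* alpha = [0; a_1, a_2, ...]^- *)
Definition has_ncf (K : realType) (alpha : K) (a : nat -> int) : Prop :=
  [/\ 0 < alpha < 1, irrational alpha &
      forall i, (0 < i)%N -> ncf_quot alpha i = a i].

(* D_{i-1} = alpha_0 ... alpha_{i-1} is ncf_prod alpha i. *)
Definition ncf_prod (K : realType) (alpha : K) (i : nat) : K :=
  \prod_(0 <= k < i) ncf_rem alpha k.

Definition ncf_expansion (K : realType) (alpha : K) (t : nat -> int) : K :=
  limn (fun n => \sum_(1 <= i < n)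
    2^-1 * (ncf_quot alpha i - 2 + t i)%:~R * ncf_prod alpha i).

Definition quot_seq (R N i : nat) : int :=
  if odd i then R%:Z else (N * R)%:Z.

Definition digit_seq (N i : nat) : int :=
  if odd i then -1 else N%:Z.

(* Main.v *)
(* With r = R, alpha is a root of X^2 = N (r X - 1), its conjugate is
   alpha' = N r - alpha, and e = r alpha - 1 is a unit. The points
   xi = n alpha - m - gamma form a coset of Z[alpha] stable under
   multiplication by e, and n xi is asymptotic to xi xi' / (alpha' - alpha) as
   xi stays bounded, so M(alpha, gamma) (alpha' - alpha) is the least norm
   |xi xi'| on the coset. Modulo powers of e one may take xi between N^(-1/2) and
   r^2 N^(1/2), where, as N grows, |xi xi'| / (N r) is close to |Y V| / (4 r^3)
   with Y = r + 1 + 2 r n and V = - (r - 1)^2 + 2 r (n - r m) integers. The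
   minimum (r + 1) (r - 1)^2 of |Y V| is attained at n = m = 0, that is, at
   xi = - gamma. *)
Require Import Defs.
From HB Require Import structures.
From mathcomp Require Import all_boot all_order all_algebra.
From mathcomp Require Import all_classical all_reals all_analysis.
From mathcomp Require Import ring lra zify.

Import Order.TTheory GRing.Theory Num.Theory.
Import numFieldNormedType.Exports.

Local Open Scope classical_set_scope.
Local Open Scope ring_scope.

(** * Action of the unit on the coset of [gamma] *)

(* [n'] and [m'] do not depend on [a], so that they serve both [alpha] and its
   conjugate. *)
Lemma orbit_step (K : realType) (R N : nat) (b1 b2 n m : int) :
  exists n' m' : int, forall a g : K,
    a ^+ 2 = N%:R * (R%:R * a - 1) ->
    (2 - R%:R * a) * g = b1%:~R * a + b2%:~R * (R%:R * a - 1) ->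
    (R%:R * a - 1) * (n%:~R * a - m%:~R - g) = n'%:~R * a - m'%:~R - g.
Proof.
exists ((N%:Z * R%:Z ^+ 2 - 1) * n - R%:Z * m + b1 + b2 * R%:Z),
  (N%:Z * R%:Z * n - m + b2) => a g ha hg.
have := congr1 (fun z => R%:R * n%:~R * z) ha; move: hg.
rewrite !(intrD, intrM, intrB) /= -!pmulrn; lra.
Qed.

(** The inverse of the unit [e = R a - 1] is [N R^2 - 1 - R a]. The hypothesis on [g] says that
    [(1 - e) g] lies in [Z + Z a], so [e] and its inverse both map the coset of [- g] into
    itself. *)
Lemma orbit_stepV (K : realType) (R N : nat) (b1 b2 n m : int) :
  exists n' m' : int, forall a g : K,
    a ^+ 2 = N%:R * (R%:R * a - 1) ->
    (2 - R%:R * a) * g = b1%:~R * a + b2%:~R * (R%:R * a - 1) ->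
    n%:~R * a - m%:~R - g = (R%:R * a - 1) * (n'%:~R * a - m'%:~R - g).
Proof.
exists (- n + R%:Z * m + b1),
  (- n * N%:Z * R%:Z + m * (N%:Z * R%:Z ^+ 2 - 1) + b1 * N%:Z * R%:Z + b2)
  => a g ha hg.
have := congr1 (fun z => R%:R * b1%:~R * z) ha.
have := congr1 (fun z => R%:R * n%:~R * z) ha.
have := congr1 (fun z => R%:R ^+ 2 * m%:~R * z) ha; move: hg.
rewrite !(intrD, intrM, intrB, intrN) /= -!pmulrn. lra.
Qed.

(** * Small powers and the distance to the nearest integer *)

Lemma expr_small (K : realType) (e c : K) :
  0 <= e <= 2^-1 -> 0 < c -> exists k, e ^+ k <= c.
Proof.
move=> /andP[e0 e1] c0; pose k := (Num.truncn c^-1).+1; exists k.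
apply: (@le_trans _ _ (2^-1 ^+ k)); first by rewrite lerXn2r ?nnegrE.
rewrite exprVn -[leRHS]invrK lef_pV2 ?posrE ?invr_gt0 ?exprn_gt0 //.
apply/ltW/(lt_trans (truncnS_gt _)); by rewrite -natrX ltr_nat ltn_expl.
Qed.

Lemma dist_int_le (K : realType) (x : K) (m : int) : dist_int x <= `|x - m%:~R|.
Proof.
apply: ge_inf; last by exists m.
by exists 0 => _ [k _ <-].
Qed.

Lemma dist_int_ge (K : realType) (x c : K) :
  (forall m : int, c <= `|x - m%:~R|) -> c <= dist_int x.
Proof.
move=> h; apply: lb_le_inf; first by exists `|x - 0%:~R|, 0.
by move=> _ [m _ <-].
Qed.

(** * From norms on the coset to the inhomogeneous liminf *)

Section Liminf.
Variables (K : realType) (a a' g g' c : K).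
Hypothesis aa' : a < a'.

Let d := a' - a.
Let xi (n m : int) : K := n%:~R * a - m%:~R - g.
Let xi' (n m : int) : K := n%:~R * a' - m%:~R - g'.

Let d_gt0 : 0 < d. Proof. by rewrite subr_gt0. Qed.

Let conj_diff n m : xi' n m - xi n m = n%:~R * d - (g' - g).
Proof. rewrite /xi /xi' /d; ring. Qed.

(** If [|xi| < 1] then [|xi'| <= |n| d + k], so [|xi| >= c / (|n| d + k)], and [|n|] times this
    tends to [c / d]. *)
Lemma inhom_liminf_ge : 0 <= c ->
  (forall n m : int, c <= `|(n%:~R * a - m%:~R - g) * (n%:~R * a' - m%:~R - g')|) ->
  ((c / (a' - a))%:E <= inhom_liminf a g)%E.
Proof.
move=> c0 hc; apply/lee_subgt0Pr => e e0.
pose k := `|g' - g| + 1.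
have k0 : 0 < k by rewrite ltr_wpDl.
have ck0 : 0 <= c * k / (d ^+ 2 * e).
  by rewrite divr_ge0 ?mulr_ge0 ?sqr_ge0 // ltW.
have cd0 : 0 <= c / d by rewrite divr_ge0 // ltW.
(* The first summand brings the bound within [e] of [c / d]; the second settles the points with
   [|xi| >= 1]. *)
pose M := (Num.truncn (c * k / (d ^+ 2 * e) + c / d)).+1.
have MP : c * k / (d ^+ 2 * e) + c / d < M%:R by rewrite truncnS_gt.
apply: le_trans (ereal_sup_ubound _); last by exists M.
apply: le_ereal_inf_tmp => _ [n /= Mn <-]; rewrite -EFinB lee_fin.
have nM : M%:R <= `|n|%:~R :> K by rewrite -[M%:R]/(M%:Z%:~R) ler_int -abszE lez_nat.
move: (`|n|%:~R : K) (intr_norm K n) nM => b bE nM.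
have b0 : 0 < b by apply: lt_le_trans nM.
have dbk : 0 < d * b + k by rewrite addr_gt0 // mulr_gt0.
have L : c / (d * b + k) <= dist_int (n%:~R * a - g).
  apply: dist_int_ge => m; rewrite addrAC -/(xi n m).
  rewrite ler_pdivrMr //.
  have [x1|x1] := leP 1 `|xi n m|.
    have : c / d <= b by lra.
    rewrite ler_pdivrMr // => cb.
    have : d * b + k <= `|xi n m| * (d * b + k) by rewrite ler_peMl // ltW.
    lra.
  apply: le_trans (hc n m) _; rewrite normrM ler_wpM2l //.
  have -> : n%:~R * a' - m%:~R - g' = xi n m + (n%:~R * d - (g' - g)).
    by rewrite -(conj_diff n m) /xi'; ring.
  have := ler_normD (xi n m) (n%:~R * d - (g' - g)).
  have := ler_normB (n%:~R * d) (g' - g).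
  rewrite normrM -bE (gtr0_norm d_gt0) /k; lra.
have bk : c * k / (d ^+ 2 * e) <= b by lra.
apply: le_trans (ler_wpM2l (ltW b0) L).
rewrite -subr_ge0.
have -> : b * (c / (d * b + k)) - (c / d - e) =
    (e * d ^+ 2 * b - c * k + e * d * k) / (d * (d * b + k)).
  by field; rewrite !gt_eqF.
rewrite divr_ge0 ?mulr_ge0 ?(ltW d_gt0) ?(ltW dbk) //.
move: bk; rewrite ler_pdivrMr ?mulr_gt0 ?exprn_gt0 //.
have : 0 <= e * d * k by rewrite !mulr_ge0 // ltW.
lra.
Qed.

Lemma inhom_liminf_le : 0 < c ->
  (forall e, 0 < e -> exists n m : int, `|n%:~R * a - m%:~R - g| < e /\
    `|(n%:~R * a - m%:~R - g) * (n%:~R * a' - m%:~R - g')| = c) ->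
  (inhom_liminf a g <= (c / (a' - a))%:E)%E.
Proof.
move=> c0 hc; apply: ge_ereal_sup => _ [M _ <-].
apply/lee_addgt0Pr => e e0.
pose k := `|g' - g| + 1.
have k0 : 0 < k by rewrite ltr_wpDl.
have Md0 : 0 <= M%:R * d by rewrite mulr_ge0 // ltW.
have kMd : 0 < M%:R * d + k by rewrite ltr_wpDl.
(* Below the second bound [|xi'|] exceeds [M d + k], which forces [|n| >= M]; below the third the
   error [|xi| k] is less than [e d]. *)
pose x0 := Num.min 1 (Num.min (c / (M%:R * d + k)) (e * d / k)).
have x00 : 0 < x0.
  by rewrite !lt_min ltr01 !divr_gt0 // ?mulr_gt0.
have [n [m []]] := hc x0 x00.
rewrite -/(xi n m) -/(xi' n m) !lt_min => /andP[x1 /andP[x2 x3]] xc.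
have xi'E : xi' n m = xi n m + (n%:~R * d - (g' - g)).
  by rewrite -(conj_diff n m); ring.
have gg := ltr_pwDr ltr01 (lexx `|g' - g|); rewrite -/k in gg.
have xp : 0 < `|xi n m|.
  by rewrite normr_gt0; apply: contraTneq c0 => z; rewrite -xc z mul0r normr0 ltxx.
rewrite normrM in xc.
apply: le_trans (ereal_inf_lbound _) _; first exists n => //=.
  rewrite -lez_nat abszE -(ler_int K) -[M%:~R]/(M%:R) intr_norm.
  rewrite -(ler_pM2r d_gt0).
  have : M%:R * d + k <= `|xi' n m|.
    move: x2; rewrite ltr_pdivlMr // -xc ltr_pM2l // => /ltW //.
  rewrite xi'E.
  have := ler_normD (xi n m) (n%:~R * d - (g' - g)).
  have := ler_normB (n%:~R * d) (g' - g).
  rewrite normrM (gtr0_norm d_gt0) /k; lra.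
rewrite -EFinD lee_fin intr_norm.
apply: (@le_trans _ _ (`|n%:~R| * `|xi n m|)).
  by rewrite ler_wpM2l // (le_trans (dist_int_le _ _ m)) // addrAC.
rewrite -(ler_pM2r d_gt0) mulrDl divfK ?gt_eqF //.
have -> : `|n%:~R| * `|xi n m| * d = `|xi n m| * `|n%:~R * d|.
  by rewrite normrM (gtr0_norm d_gt0); ring.
have -> : n%:~R * d = xi' n m - xi n m + (g' - g) by rewrite (conj_diff n m); ring.
have h1 : `|xi' n m - xi n m + (g' - g)| <= `|xi' n m| + k.
  have := ler_normD (xi' n m - xi n m) (g' - g).
  have := ler_normB (xi' n m) (xi n m); rewrite /k; lra.
apply: le_trans (ler_wpM2l (ltW xp) h1) _.
rewrite mulrDr xc lerD2l.
by move: x3; rewrite ltr_pdivlMr // => /ltW.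
Qed.
End Liminf.

(** * Periodicity of the algorithm and the closed form of [gamma] *)

Section Expansion.
Variables (K : realType) (R N : nat) (a : K).
Hypotheses (hR : (3 <= R)%N) (hN : (0 < N)%N) (ha : has_ncf a (quot_seq R N)).

Let rem := ncf_rem a.

Lemma irrational_ncf_step (x : K) : irrational x -> irrational (ncf_step x).
Proof.
move=> xirr [q _ qE]; apply: xirr; exists ((Num.ceil x^-1)%:~R - q)^-1 => //.
by rewrite fmorphV rmorphB /= ratr_int qE /ncf_step; rewrite opprB addrC subrK invrK.
Qed.

Lemma irrational_ncf_rem i : irrational (rem i).
Proof.
elim: i => [|i IH]; first by case: ha.
exact: irrational_ncf_step.
Qed.

Lemma ncf_rem_bounds i : 0 < rem i < 1.
Proof.
case: i => [|i]; first by case: ha.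
have r0 : rem i.+1 != 0.
  apply/eqP => h; apply: (irrational_ncf_rem i.+1).
  by exists 0 => //; rewrite rmorph0 h.
have /andP[] := ceil_itv (rem i)^-1; rewrite intrB => h1 h2.
have rE : rem i.+1 = (Num.ceil (rem i)^-1)%:~R - (rem i)^-1 by [].
by rewrite lt_def r0 rE andTb; apply/andP; split; lra.
Qed.

Lemma ncf_remS i : rem i.+1 = (quot_seq R N i.+1)%:~R - (rem i)^-1.
Proof. by case: ha => _ _ /(_ i.+1 isT) <-. Qed.

Lemma quot_seq_ge3 i : (3 <= quot_seq R N i)%R.
Proof. rewrite /quot_seq; case: odd; nia. Qed.

(** A quotient of at least 3 and a next remainder below 1 give [1 / x > 2]. This bound drives both
    the contraction behind periodicity and the decay of the products. *)
Lemma ncf_rem_lt_half i : rem i < 2^-1.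
Proof.
have /andP[r0 _] := ncf_rem_bounds i; have /andP[_ r1] := ncf_rem_bounds i.+1.
have : 3 <= (quot_seq R N i.+1)%:~R :> K by rewrite (ler_int _ 3) quot_seq_ge3.
rewrite ncf_remS in r1 => q3.
have h : 2 < (rem i)^-1 by lra.
by rewrite -[ltLHS]invrK ltf_pV2 ?posrE ?invr_gt0.
Qed.

(* Both remainders satisfy [1 / x_i = a_(i+1) - x_(i+1)] with the same partial
   quotient, so their distance shrinks by a factor 4 at each backward step. *)
Lemma ncf_rem_period_dist k i : `|rem i - rem i.+2| <= 4^-1 ^+ k.
Proof.
elim: k i => [|k IH] i.
  have /andP[? ?] := ncf_rem_bounds i; have /andP[? ?] := ncf_rem_bounds i.+2.
  by rewrite expr0 ler_norml; apply/andP; split; lra.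
have /andP[r0 _] := ncf_rem_bounds i; have /andP[r2 _] := ncf_rem_bounds i.+2.
have -> : rem i - rem i.+2 = rem i * rem i.+2 * (rem i.+1 - rem i.+3).
  rewrite (ncf_remS i) (ncf_remS i.+2).
  have -> : quot_seq R N i.+3 = quot_seq R N i.+1 by rewrite /quot_seq /= negbK.
  by field; rewrite !gt_eqF.
rewrite normrM exprS gtr0_norm ?mulr_gt0 // ler_pM ?(ltW (mulr_gt0 r0 r2)) //.
have -> : 4^-1 = 2^-1 * 2^-1 :> K by field.
by rewrite ltW // ltr_pM // ?ncf_rem_lt_half // ltW.
Qed.

Lemma ncf_rem_period i : rem i.+2 = rem i.
Proof.
apply/esym/eqP; rewrite -subr_eq0 -normr_eq0 -[_ == 0]negbK -normr_gt0 normr_id.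
apply/negP => z0; have z1 : 0 < `|rem i - rem i.+2| / 2 by rewrite divr_gt0.
have [|k] := expr_small K 4^-1 _ _ z1; first by apply/andP; split; lra.
by have := ncf_rem_period_dist k i; lra.
Qed.

Lemma ncf_remE i : rem i = if odd i then R%:R - a^-1 else a.
Proof.
elim/ltn_ind: i => -[|[|i]] IH //; first by rewrite ncf_remS.
by rewrite ncf_rem_period IH //= negbK.
Qed.

Lemma ncf_gt0 : 0 < a. Proof. by case: ha => /andP[]. Qed.

Lemma ncf_lt_half : a < 2^-1. Proof. exact: (ncf_rem_lt_half 0). Qed.

(** By periodicity [a * rem 1] equals both [R a - 1] and [N R * rem 1 - 1]; comparison gives
    [a = N * rem 1]. *)
Lemma ncf_quadratic : a ^+ 2 = N%:R * (R%:R * a - 1).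
Proof.
have a0 := ncf_gt0; have /andP[b0 _] := ncf_rem_bounds 1.
have := ncf_remS 1; have bE : rem 1 = R%:R - a^-1 := ncf_remE 1.
rewrite ncf_rem_period [rem 0]/= => aE.
have abE : a * rem 1 = R%:R * a - 1 by rewrite bE; field; rewrite gt_eqF.
have baE : a * rem 1 = N%:R * R%:R * rem 1 - 1.
  by rewrite {1}aE /quot_seq /= -pmulrn natrM; field; rewrite gt_eqF.
have R0 : R%:R != 0 :> K by rewrite pnatr_eq0 -lt0n (leq_trans _ hR).
have : N%:R * rem 1 = a by apply: (mulfI R0); lra.
by move=> nE; rewrite -abE expr2 -{1}nE; ring.
Qed.

Lemma ncf_prodS i : ncf_prod a i.+1 = ncf_prod a i * rem i.
Proof. by rewrite /ncf_prod big_nat_recr. Qed.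

Lemma ncf_prod_le i : 0 <= ncf_prod a i <= 2^-1 ^+ i.
Proof.
elim: i => [|i /andP[h1 h2]].
  by rewrite /ncf_prod big_geq // expr0 ler01 lexx.
have /andP[/ltW r0 _] := ncf_rem_bounds i.
by rewrite ncf_prodS exprSr mulr_ge0 //= ler_pM // ltW // ncf_rem_lt_half.
Qed.

Variable g : K.
(** A geometric series summed: the first two terms are on the right, since [a * rem 1 = R a - 1],
    and each period multiplies the products by [R a - 1], whose complement to 1 is [2 - R a]. *)
Hypothesis hg : (2 - R%:R * a) * g =
  2^-1 * (R%:R - 3) * a + 2^-1 * (N%:R * (R%:R + 1) - 2) * (R%:R * a - 1).

(** Sum of the terms of index at least [n]: for odd [n] a whole period starts, giving a scaled copy
    of [g]; for even [n] the first term of that copy is missing. *)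
Let tail n := ncf_prod a n.-1 * if odd n then g else g / a - 2^-1 * (R%:R - 3).

Lemma ncf_expansion_partial n :
  \sum_(1 <= i < n.+1)
    2^-1 * (ncf_quot a i - 2 + digit_seq N i)%:~R * ncf_prod a i = g - tail n.+1.
Proof.
have a0 := ncf_gt0.
elim: n => [|n IH].
  by rewrite big_geq // /tail /= /ncf_prod big_geq // mul1r subrr.
rewrite big_nat_recr //= IH /tail /= ncf_prodS ncf_remE.
case: ha => _ _ /(_ n.+1 isT) ->.
rewrite /quot_seq /digit_seq /= negbK; case: (odd n) => /=.
  rewrite !(intrD, intrB, intrN) -!pmulrn natrM.
  apply: (mulIf (lt0r_neq0 a0)).
  have := congr1 (fun z => ncf_prod a n * z) hg.
  have -> : (g - ncf_prod a n * (g / a - 2^-1 * (R%:R - 3)) +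
     2^-1 * (N%:R * R%:R - 2 + N%:R) * (ncf_prod a n * (R%:R - a^-1))) * a =
    g * a - ncf_prod a n * (g - 2^-1 * (R%:R - 3) * a) +
     2^-1 * (N%:R * R%:R - 2 + N%:R) * (ncf_prod a n * (R%:R * a - 1)).
    by field; rewrite gt_eqF.
  have -> : (g - ncf_prod a n * (R%:R - a^-1) * g) * a =
    g * a - ncf_prod a n * (R%:R * a - 1) * g.
    by field; rewrite gt_eqF.
  lra.
by rewrite !(intrD, intrB, intrN) -!pmulrn; field; rewrite gt_eqF.
Qed.

Lemma ncf_expansionE : ncf_expansion a (digit_seq N) = g.
Proof.
apply: cvg_lim => //; rewrite -(cvg_shiftS _).
under eq_fun do rewrite ncf_expansion_partial.
suff h : tail n.+1 @[n --> \oo] --> 0.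
  by rewrite -[in nbhs _](subr0 g); apply: cvgB => //; exact: cvg_cst.
pose G := `|g| + `|g / a - 2^-1 * (R%:R - 3)|.
have hG : geometric G 2^-1 n @[n --> \oo] --> (0 : K).
  by apply: cvg_geometric; rewrite gtr0_norm //; lra.
apply/norm_cvg0P; apply: (squeeze_cvgr _ (cvg_cst 0) hG).
apply: nearW => n; rewrite normr_ge0 /= /tail normrM.
have /andP[h1 h2] := ncf_prod_le n.
rewrite mulrC (ger0_norm h1); apply: (@ler_pM _ _ G _ (2^-1 ^+ n)) => //.
by rewrite /G; case: ifP; rewrite ?lerDl ?lerDr.
Qed.

End Expansion.

(** * The minimum of the limiting integer form *)

Lemma odd_product_ge (R q k l : int) : 3 <= R -> R = 2 * q + 1 ->
  let y := R + 1 + 2 * R * k in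
  let v := - (R - 1) ^+ 2 + 2 * R * (k - R * l) in
  [/\ R - 1 <= `|y|, R - 1 <= `|v| & (R + 1) * (R - 1) ^+ 2 <= `|y * v|].
Proof.
move=> R3 Rq /=; set y := _ + _ * k; set v := _ + _ * (k - _).
(* [y] and [- v] are congruent to [R + 1] modulo [2 R], and their sum to
   [R ^ 2 - R + 2] modulo [2 R ^ 2]. *)
have hy : (R + 1 <= y) || (y <= 1 - R) by rewrite /y; have [|] := lerP 0 k; nia.
(* As [R] is odd, [R ^ 2] is [R] modulo [2 R], so [(R - 1) ^ 2] is [R + 1]. *)
pose r := q - 1 + R * l - k.
have vE : - v = R + 1 + 2 * R * r by rewrite /v /r Rq; ring.
have hv : (R + 1 <= - v) || (- v <= 1 - R) by rewrite vE; have [|] := lerP 0 r; nia.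
have hs : (R ^+ 2 - R + 2 <= y - v) || (y - v <= - (R ^+ 2 + R - 2)).
  have -> : y - v = R ^+ 2 - R + 2 + 2 * R ^+ 2 * l by rewrite /v /y; ring.
  by have [|] := lerP 0 l; nia.
clearbody y v; clear r vE Rq; rewrite !ler_normr; split; [lia|lia|].
(* For equal signs of [y] and [- v], the product is least with one factor at its own bound:
   [(R + 1) (R^2 - 2 R + 1)] if positive, [(R - 1) (R^2 - 1)] if negative, both the claimed value.
   For opposite signs the sum forces one factor to be larger still. *)
case/orP: hy => hy; case/orP: hv => hv; case/orP: hs => hs; apply/orP.
- right. nia.
- lia.
- left. nia.
- left. nia.
- left. nia.
- left. nia.
- lia.
- right. nia.
Qed.

(** * Approximation of a point and its conjugate for large [nu] *)

(** Since [r a - 1 = a^2 h^2], [a] is within [O(h^2)] of [1 / r] and [nu r - a] is close to [nu r];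
    coordinates of size [O(1 / h)] thus leave errors [O(h)]. The terms in [w] cancel the
    [nu]-dependent part of the coordinates of [- center]. *)
Lemma pell_approx (K : realType) (r nu h x y a : K) :
  3 <= r -> 0 < h <= 1 -> nu * h ^+ 2 = 1 -> 0 < a < 2^-1 ->
  a ^+ 2 = nu * (r * a - 1) ->
  let w := (r - 2) / (r * (nu * r ^+ 2 - 4)) in
  0 <= w <= h ^+ 2 /\
  (`|y| * h <= 2 * r + 1 -> `|x + y * a| * h <= r ^+ 2 ->
   `|x + y * a - (x - 2 * w / r + (y + w) / r)| <= (r + 4) * h /\
   `|(x + y * (nu * r - a)) / (nu * r) - (y + w)| <= (r + 4) * h).
Proof.
move=> r3 /andP[h0 h1] nuh /andP[a0 a1] aq.
have hh : 0 < h ^+ 2 by rewrite exprn_gt0.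
have hh1 : h ^+ 2 <= h by rewrite expr2 ler_piMl // ltW.
have nuE : nu = (h ^+ 2)^-1 by rewrite -[nu](mulfK (lt0r_neq0 hh)) nuh mul1r.
have nu1 : 1 <= nu by rewrite nuE invf_ge1 // (le_trans hh1).
have D0 : 0 < nu * r ^+ 2 - 4 by nra.
have eE : r * a - 1 = a ^+ 2 * h ^+ 2 by rewrite aq mulrAC nuh mul1r.
have r0 : r != 0 by lra.
have D1 : nu * r ^+ 2 - 4 != 0 by rewrite gt_eqF.
move=> w.
have w01 : 0 <= w <= h ^+ 2.
  have rD : 0 < r * (nu * r ^+ 2 - 4) by rewrite mulr_gt0 //; lra.
  rewrite divr_ge0 /=; [|lra|exact: ltW].
  rewrite ler_pdivrMr //.
  have -> : h ^+ 2 * (r * (nu * r ^+ 2 - 4)) = r ^+ 3 * (nu * h ^+ 2) - 4 * r * h ^+ 2 by ring.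
  rewrite nuh. nra.
split=> // hy hx; case/andP: w01 => w0 w1.
have ay : `|y| * h ^+ 2 <= (2 * r + 1) * h.
  by rewrite expr2 mulrA ler_wpM2r // ltW.
have ax : `|x + y * a| * h ^+ 2 <= r ^+ 2 * h.
  by rewrite expr2 mulrA ler_wpM2r // ltW.
have rp : 0 < r by lra.
have wr : w / r <= h by rewrite ler_pdivrMr //; nra.
have wr0 : 0 <= w / r by rewrite divr_ge0 // ltW.
split.
  have -> : x + y * a - (x - 2 * w / r + (y + w) / r) = w / r + y * (r * a - 1) / r.
    by field.
  apply: le_trans (ler_normD _ _) _; rewrite (ger0_norm wr0) eE.
  rewrite 3!normrM normfV (gtr0_norm rp) (ger0_norm (sqr_ge0 a)) (gtr0_norm hh).
  have : `|y| * (a ^+ 2 * h ^+ 2) / r <= (2 * r + 1) * h / r.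
    rewrite ler_pM2r ?invr_gt0 //; apply: le_trans ay.
    by rewrite mulrCA ler_piMl ?mulr_ge0 ?(ltW hh) //; nra.
  have : (2 * r + 1) * h / r <= 3 * h by rewrite ler_pdivrMr //; nra.
  nra.
have -> : (x + y * (nu * r - a)) / (nu * r) - (y + w) =
    (x + y * a) * h ^+ 2 / r - 2 * a * y * h ^+ 2 / r - w.
  by rewrite nuE; field; rewrite r0 gt_eqF.
apply: le_trans (ler_normB _ _) _; rewrite (ger0_norm w0).
apply: (@le_trans _ _ (r * h + 3 * h + h)); last by nra.
rewrite lerD //; last by lra.
apply: le_trans (ler_normB _ _) _.
rewrite [h ^+ 2]lock !(normrM, normfV) -lock.
rewrite (gtr0_norm rp) (gtr0_norm hh) (gtr0_norm a0) (gtr0_norm (ltr0Sn K 1)).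
rewrite lerD //.
  by rewrite ler_pdivrMr // (le_trans ax) //; nra.
rewrite ler_pdivrMr // -mulrA.
have : 2 * a * (`|y| * h ^+ 2) <= `|y| * h ^+ 2.
  by rewrite ler_piMl ?mulr_ge0 ?(ltW hh) //; lra.
nra.
Qed.

(* [- center] has coordinates [(- 1/2 + (r - 2) / (2 r^2) + 2 w / r,
   1/2 + 1 / (2 r) - w)] in the basis [(1, a)]; [w] is the part that vanishes as
   [nu] grows. For [nu = N] and [a = alpha], [center] is the closed form of
   [gamma]; at the conjugate of [alpha] it gives the conjugate of [gamma]. *)
Definition center {K : realType} (r nu a : K) : K :=
  let w := (r - 2) / (r * (nu * r ^+ 2 - 4)) in
  2^-1 - (r - 2) / (2 * r ^+ 2) - 2 * w / r - (2^-1 + (2 * r)^-1 - w) * a.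

(** * Norm bounds on the coset for a fixed [N] *)

Section Cosets.
Variables (K : realType) (R N : nat) (a h : K).
Hypotheses (hR : (3 <= R)%N) (hRodd : odd R).
Hypotheses (h01 : 0 < h <= 1) (Nh : N%:R * h ^+ 2 = 1).
Hypotheses (ha : 0 < a < 2^-1) (aq : a ^+ 2 = N%:R * (R%:R * a - 1)).
Hypothesis airr : irrational a.

Let r : K := R%:R.
Let nu : K := N%:R.
Let a' := nu * r - a.
Let w := (r - 2) / (r * (nu * r ^+ 2 - 4)).
Let kappa := r ^+ 2 * (r + 4).
Let C := 4^-1 * (1 - r^-1) * (1 - (r ^+ 2)^-1).
Let xi (n m : int) := n%:~R * a - m%:~R - center r nu a.
Let xi' (n m : int) := n%:~R * a' - m%:~R - center r nu a'.
Let Y (n : int) : K := r + 1 + 2 * r * n%:~R.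
Let V (n m : int) : K := - (r - 1) ^+ 2 + 2 * r * (n%:~R - r * m%:~R).

Let r3 : 3 <= r. Proof. by rewrite ler_nat. Qed.
Let rp : 0 < r. Proof. exact: lt_le_trans r3. Qed.
Let h0 : 0 < h. Proof. by case/andP: h01. Qed.
Let nu1 : 1 <= nu.
Proof.
have h2 : 0 < h ^+ 2 by rewrite exprn_gt0.
have -> : nu = (h ^+ 2)^-1 by rewrite -[nu](mulfK (lt0r_neq0 h2)) Nh mul1r.
by rewrite invf_ge1 // expr_le1 ?(ltW h0) //; case/andP: h01.
Qed.
Let D0 : nu * r ^+ 2 - 4 != 0.
Proof.
have ? : 0 < nu * r ^+ 2 - 4 by have := nu1; have := r3; nra.
by rewrite gt_eqF.
Qed.

Let aq' : a' ^+ 2 = nu * (r * a' - 1).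
Proof. have := aq; rewrite /a' -/nu -/r; lra. Qed.

Lemma centerE (b : K) : b ^+ 2 = nu * (r * b - 1) ->
  (2 - r * b) * center r nu b =
  2^-1 * (r - 3) * b + 2^-1 * (nu * (r + 1) - 2) * (r * b - 1).
Proof.
move=> bq; apply/eqP; rewrite -subr_eq0.
have -> : (2 - r * b) * center r nu b - (2^-1 * (r - 3) * b +
    2^-1 * (nu * (r + 1) - 2) * (r * b - 1)) =
    r * (2^-1 + (2 * r)^-1 - w) * (b ^+ 2 - nu * (r * b - 1)).
  by rewrite /center /w; field; rewrite D0 gt_eqF.
by rewrite bq subrr mulr0.
Qed.

Lemma conj_unit : (r * a - 1) * (r * a' - 1) = 1.
Proof.
have := congr1 (fun z => r ^+ 2 * z) aq; rewrite /a' -/nu -/r /=.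
by lra.
Qed.

Lemma cell_approx (n m : int) :
  `|n%:~R + 2^-1 + (2 * r)^-1 - w| * h <= 2 * r + 1 -> `|xi n m| * h <= r ^+ 2 ->
  `|xi n m - V n m / (2 * r ^+ 2)| <= (r + 4) * h /\
  `|xi' n m / (nu * r) - Y n / (2 * r)| <= (r + 4) * h.
Proof.
have r0 : r != 0 by rewrite gt_eqF.
pose x := - m%:~R - 2^-1 + (r - 2) / (2 * r ^+ 2) + 2 * w / r.
pose y := n%:~R + 2^-1 + (2 * r)^-1 - w.
have -> : xi n m = x + y * a.
  by rewrite /xi /center -/w /x /y; ring.
have -> : xi' n m = x + y * (nu * r - a).
  by rewrite /xi' /center -/w /x /y /a'; ring.
have -> : V n m / (2 * r ^+ 2) = x - 2 * w / r + (y + w) / r.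
  by rewrite /x /y /V; field.
have -> : Y n / (2 * r) = y + w by rewrite /y /Y; field.
have [_] := pell_approx K r nu h x y a r3 h01 Nh ha aq.
by rewrite -/w => H h1 h2; apply: H.
Qed.

Lemma cell_bounds (n m : int) :
  [/\ r ^- 2 <= `|Y n / (2 * r)|, r ^- 2 <= `|V n m / (2 * r ^+ 2)| &
      C <= `|Y n / (2 * r)| * `|V n m / (2 * r ^+ 2)|].
Proof.
have R3 : 3 <= R%:Z by rewrite lez_nat.
have Rq : R%:Z = 2 * (R./2)%:Z + 1.
  by rewrite -[in LHS](odd_double_half R) hRodd; lia.
have [] := odd_product_ge _ _ n m R3 Rq.
rewrite -!(ler_int K) !intr_norm.
rewrite !(intrD, intrM, intrN, intrB, rmorphXn) /= -!pmulrn -/r -/(Y n) -/(V n m).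
move=> yb vb yvb.
have r20 : 0 < r ^+ 2 by rewrite exprn_gt0.
have -> : `|Y n / (2 * r)| = `|Y n| / (2 * r).
  by rewrite normrM [X in _ * X]gtr0_norm ?invr_gt0 ?mulr_gt0.
have -> : `|V n m / (2 * r ^+ 2)| = `|V n m| / (2 * r ^+ 2).
  by rewrite normrM [X in _ * X]gtr0_norm ?invr_gt0 ?mulr_gt0.
split.
- rewrite ler_pdivlMr ?mulr_gt0 //.
  have -> : r ^- 2 * (2 * r) = 2 / r by field; rewrite gt_eqF.
  have : 2 / r <= 1 by rewrite ler_pdivrMr //; have := r3; lra.
  by have := r3; lra.
- rewrite ler_pdivlMr ?mulr_gt0 //.
  have -> : r ^- 2 * (2 * r ^+ 2) = 2 by field; rewrite gt_eqF.
  by have := r3; lra.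
rewrite normrM in yvb.
have -> : `|Y n| / (2 * r) * (`|V n m| / (2 * r ^+ 2)) = `|Y n| * `|V n m| / (4 * r ^+ 3).
  by field; rewrite gt_eqF.
rewrite ler_pdivlMr ?mulr_gt0 ?exprn_gt0 //.
apply: le_trans yvb; rewrite le_eqVlt; apply/orP; left; apply/eqP.
by rewrite /C; field; rewrite gt_eqF.
Qed.

(* If the norm is small, the window for [xi] forces both coordinates to be
   [O(1 / h)], so that [xi] and [xi' / (nu r)] are within [O(h)] of the rational
   numbers [V / (2 r^2)] and [Y / (2 r)], which are bounded away from [0]. *)
Lemma norm_ge_window (n m : int) : kappa * h <= 1 ->
  h <= `|xi n m| -> `|xi n m| * h <= r ^+ 2 ->
  nu * r * C * (1 - kappa * h) ^+ 2 <= `|xi n m * xi' n m|.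
Proof.
move=> kh hx xh; rewrite leNgt; apply/negP => lt.
have nur : 0 < nu * r by rewrite mulr_gt0 // (lt_le_trans ltr01).
have nr1 : r <= nu * r by rewrite ler_peMl // ltW.
have kh0 : 0 <= kappa * h by rewrite !mulr_ge0 ?exprn_ge0 ?addr_ge0 // ltW.
have rV : 0 < r^-1 < 1 by rewrite invr_gt0 rp invf_lt1 //=; have := r3; lra.
have C0 : 0 <= C <= 4^-1.
  move: rV; rewrite /C -exprVn; move: r^-1 => z /andP[z0 z1].
  have z2 : 0 <= 1 - z ^+ 2 by nra.
  have z3 : 1 - z ^+ 2 <= 1 by nra.
  have z4 : 0 <= (1 - z) * (1 - z ^+ 2) by rewrite mulr_ge0 // ltW // subr_gt0.
  by apply/andP; split; nra.
have pub : `|xi' n m| * h <= nu * r / 4.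
  have : nu * r * C * (1 - kappa * h) ^+ 2 <= nu * r / 4.
    case/andP: C0 => ? ?; rewrite -mulrA ler_pM2l //.
    have : (1 - kappa * h) ^+ 2 <= 1 by nra.
    have := sqr_ge0 (1 - kappa * h); nra.
  have : h * `|xi' n m| <= `|xi n m| * `|xi' n m| by rewrite ler_wpM2r.
  rewrite normrM in lt; lra.
(* The difference [xi' - xi] is [nu r - 2 a] times the [a]-coordinate, so bounds on both conjugates
   bound that coordinate. *)
have yh : `|n%:~R + 2^-1 + (2 * r)^-1 - w| * h <= 2 * r + 1.
  set y := _ - w.
  have yE : y * (nu * r - 2 * a) = xi' n m - xi n m.
    by rewrite /y /xi' /xi /center -/w /a'; ring.
  have : `|y| * (nu * r - 1) <= `|xi' n m| + `|xi n m|.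
    rewrite -[`|xi n m|]normrN; apply: le_trans (ler_normD _ _).
    rewrite -yE normrM ler_wpM2l //; case/andP: ha => ? ?.
    apply: le_trans (ler_norm _); lra.
  have := r3; have := normr_ge0 y; have := h0; move: pub xh.
  move: `|_| `|_| `|y| => p q z; nra.
have [xU xY] := cell_approx n m yh xh.
have [Yb Ub CUY] := cell_bounds n m.
(* As [|t| >= r ^- 2], an error [(r + 4) h] is at most the fraction [kappa h] of [|t|]; each of the
   two factors loses this once, whence the square. *)
have red (z t : K) : r ^- 2 <= `|t| -> `|z - t| <= (r + 4) * h ->
    `|t| * (1 - kappa * h) <= `|z|.
  move=> tb zt; have := ler_normB z (z - t).
  rewrite opprB addrC subrK => tz.
  have : (r + 4) * h <= `|t| * (kappa * h).
    have : r ^- 2 * (kappa * h) <= `|t| * (kappa * h) by rewrite ler_wpM2r.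
    have -> // : r ^- 2 * (kappa * h) = (r + 4) * h.
    by rewrite /kappa; field; rewrite gt_eqF.
  lra.
move: lt; rewrite ltNge => /negP; apply.
have -> : `|xi n m * xi' n m| = nu * r * (`|xi' n m / (nu * r)| * `|xi n m|).
  rewrite !normrM normfV (gtr0_norm nur); field.
  by rewrite gt_eqF // gt_eqF // (lt_le_trans ltr01).
rewrite -mulrA ler_pM2l //.
have e1 : 0 <= 1 - kappa * h by lra.
apply: le_trans (ler_pM _ _ (red _ _ Yb xY) (red _ _ Ub xU)); rewrite ?mulr_ge0 //.
by rewrite [leRHS]mulrACA -expr2 ler_wpM2r ?sqr_ge0.
Qed.

(** The last bound says that the unit is at least the ratio of [h] to [r^2 / h], so one
    multiplication cannot jump over that window. *)
Lemma unit_bounds : 0 < r * a - 1 <= 2^-1 /\ h ^+ 2 <= (r * a - 1) * r ^+ 2.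
Proof.
have h2 : 0 < h ^+ 2 by rewrite exprn_gt0.
have eE : r * a - 1 = a ^+ 2 * h ^+ 2 by rewrite aq mulrAC Nh mul1r.
case/andP: ha => a0 a1; case/andP: h01 => _ h1.
have ar : 1 <= a * r.
  have : 0 <= a ^+ 2 * h ^+ 2 by rewrite mulr_ge0 ?sqr_ge0.
  by rewrite -eE; lra.
split; rewrite eE; last first.
  rewrite mulrAC -exprMn ler_peMl ?(ltW h2) //; nra.
rewrite mulr_gt0 ?exprn_gt0 //=.
apply: (@le_trans _ _ (a ^+ 2)); last by nra.
by rewrite ler_piMr ?sqr_ge0 // expr_le1 // ltW.
Qed.

(** Oddness of [R] makes the coefficients in [centerE] integers, as stability of the coset under the
    unit requires. *)
Lemma center_digits : exists b1 b2 : int, forall b : K,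
  b ^+ 2 = nu * (r * b - 1) ->
  (2 - r * b) * center r nu b = b1%:~R * b + b2%:~R * (r * b - 1).
Proof.
exists ((R./2)%:Z - 1), (N%:Z * ((R./2)%:Z + 1) - 1) => b /centerE ->.
have rE : r = 2 * (R./2)%:R + 1.
  by rewrite /r -[in LHS](odd_double_half R) hRodd natrD -mul2n natrM addrC.
rewrite !(intrD, intrM, intrN, intrB) -!pmulrn -/nu rE; by field.
Qed.

Lemma coset_step (n m : int) : exists n' m',
  xi n' m' = (r * a - 1) * xi n m /\ xi' n' m' = (r * a' - 1) * xi' n m.
Proof.
have [b1 [b2 cE]] := center_digits.
have [n' [m' H]] := orbit_step K R N b1 b2 n m; exists n', m'.
by rewrite /xi /xi'; split; rewrite -H //; exact: cE.
Qed.

Lemma coset_stepV (n m : int) : exists n' m',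
  xi n m = (r * a - 1) * xi n' m' /\ xi' n m = (r * a' - 1) * xi' n' m'.
Proof.
have [b1 [b2 cE]] := center_digits.
have [n' [m' H]] := orbit_stepV K R N b1 b2 n m; exists n', m'.
by rewrite /xi /xi'; split; rewrite -H //; exact: cE.
Qed.

(** The [a]-coordinate is rational and lies strictly between [n] and [n + 1], hence is nonzero; a
    zero of [xi] would make [a] rational. *)
Lemma xi_neq0 (n m : int) : xi n m != 0.
Proof.
have nu0 : nu != 0 by rewrite gt_eqF // (lt_le_trans ltr01).
have [wq wE] : exists q, ratr q = w.
  exists ((R%:R - 2) / (R%:R * (N%:R * R%:R ^+ 2 - 4))).
  by rewrite fmorph_div !(rmorphM, rmorphB, rmorphXn, rmorph_nat).
have [y yE] : exists q, ratr q = n%:~R + 2^-1 + (2 * r)^-1 - w.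
  exists (n%:~R + 2^-1 + (2 * R%:R)^-1 - wq).
  by rewrite !(rmorphD, rmorphN) /= wE !fmorphV !rmorphM !rmorph_nat ratr_int.
have [x xE] : exists q, ratr q = m%:~R + 2^-1 - (r - 2) / (2 * r ^+ 2) - 2 * w / r.
  exists (m%:~R + 2^-1 - (R%:R - 2) / (2 * R%:R ^+ 2) - 2 * wq / R%:R).
  rewrite !(rmorphD, rmorphN) /= !fmorph_div !(rmorphM, rmorphB) /= wE !fmorphV.
  by rewrite !rmorph_nat ratr_int.
have xiE : xi n m = ratr y * a - ratr x.
  by rewrite yE xE /xi /center -/w; ring.
have [w0 w1] : 0 <= w /\ w < 2^-1.
  have r9 : 9 <= r ^+ 2 by have := r3; nra.
  have rD : 5 * r <= r * (nu * r ^+ 2 - 4).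
    by rewrite mulrC ler_pM2l //; have := nu1; nra.
  have rD0 : 0 < r * (nu * r ^+ 2 - 4) by have := rp; lra.
  split; first by rewrite divr_ge0 ?(ltW rD0) //; have := r3; lra.
  by rewrite ltr_pdivrMr //; have := rp; lra.
have r2 : 0 < (2 * r)^-1 < 2^-1.
  rewrite invr_gt0 mulr_gt0 //= ltf_pV2 ?posrE ?mulr_gt0 //; have := r3; lra.
have y0 : y != 0.
  apply/eqP => y0; move: yE; rewrite y0 rmorph0 => yE; case/andP: r2 => ? ?.
  have : (-1)%:~R < n%:~R :> K by rewrite mulrN1z; lra.
  have : n%:~R < 0%:~R :> K by rewrite mulr0z; lra.
  by rewrite !ltr_int; clear; lia.
apply/eqP => xi0; apply: airr; exists (x / y) => //.
have y0' : ratr y != 0 :> K by rewrite fmorph_eq0.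
apply: (mulIf y0'); rewrite fmorph_div divfK //.
by move/eqP: xi0; rewrite xiE subr_eq0 mulrC => /eqP.
Qed.

Hypothesis kh : kappa * h < 1.

Let B := nu * r * C * (1 - kappa * h) ^+ 2.

Let norm_mul (s t z z' : K) : s * t = 1 -> `|(s * z) * (t * z')| = `|z * z'|.
Proof. by move=> st; rewrite mulrACA st mul1r. Qed.

(* Multiplication by the unit [r a - 1] permutes the coset, and the window
   [h, r^2 / h] contains a point of every geometric progression of its ratio. *)
Lemma norm_ge (n m : int) : B <= `|xi n m * xi' n m|.
Proof.
have [/andP[e0 e1] er] := unit_bounds.
have st := conj_unit.
set e := r * a - 1 in e0 e1 er st.
have r2h : 0 < r ^+ 2 / h by rewrite divr_gt0 ?exprn_gt0.
have win n1 m1 : h <= `|xi n1 m1| -> `|xi n1 m1| <= r ^+ 2 / h ->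
    B <= `|xi n1 m1 * xi' n1 m1|.
  by move=> h1; rewrite ler_pdivlMr // => h2; exact: norm_ge_window (ltW kh) h1 h2.
(* [k] bounds the number of multiplications still needed; above the window, one of them leaves
   [|xi|] at least [h] by [er]. Below the window, [up] divides instead. *)
have down k : forall n1 m1, h <= `|xi n1 m1| -> `|xi n1 m1| * e ^+ k <= r ^+ 2 / h ->
    B <= `|xi n1 m1 * xi' n1 m1|.
  elim: k => [|k IH] n1 m1 h1 h2; first by apply: win => //; rewrite -[leLHS]mulr1.
  have [h3|h3] := leP `|xi n1 m1| (r ^+ 2 / h); first exact: win.
  have [n2 [m2 [E E']]] := coset_step n1 m1.
  rewrite -(norm_mul _ _ _ _ st) -E -E'; apply: IH; rewrite E normrM (gtr0_norm e0).
    rewrite -[h](mulfK (lt0r_neq0 h0)) -expr2 ler_pdivrMr //.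
    apply: le_trans er _; rewrite -mulrA ler_pM2l //.
    by move: h3; rewrite ltr_pdivrMr // => /ltW.
  by apply: le_trans h2; rewrite exprS mulrA [e * _]mulrC.
have up k : forall n1 m1, h * e ^+ k <= `|xi n1 m1| -> `|xi n1 m1| <= r ^+ 2 / h ->
    B <= `|xi n1 m1 * xi' n1 m1|.
  elim: k => [|k IH] n1 m1 h1 h2; first by apply: win => //; rewrite -[leLHS]mulr1.
  have [h3|h3] := leP h `|xi n1 m1|; first exact: win.
  have [n2 [m2 [E E']]] := coset_stepV n1 m1.
  rewrite E E' norm_mul //; move: h1 h3; rewrite E normrM (gtr0_norm e0) => h1 h3.
  apply: IH.
    by rewrite -(ler_pM2l e0); apply: le_trans h1; rewrite exprS mulrCA.
  rewrite -(ler_pM2l e0); apply: le_trans (ltW h3) _.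
  by rewrite mulrA ler_pdivlMr // -expr2.
have e01 : 0 <= e <= 2^-1 by rewrite ltW.
have [h1|h1] := leP h `|xi n m|.
  have x0 : 0 < `|xi n m| by apply: lt_le_trans h1.
  have [k hk] := expr_small _ _ _ e01 (divr_gt0 r2h x0).
  by apply: (down k) => //; rewrite mulrC -ler_pdivlMr.
have x0 : 0 < `|xi n m| by rewrite normr_gt0 xi_neq0.
have [k hk] := expr_small _ _ _ e01 (divr_gt0 x0 h0).
apply: (up k); first by rewrite mulrC -ler_pdivlMr.
apply: le_trans (ltW h1) _; rewrite ler_pdivlMr // -expr2.
apply: le_trans er _; rewrite ler_piMl ?exprn_ge0 ?ltW //.
by apply: le_lt_trans e1 _; lra.
Qed.

(** Powers of the unit move [xi 0 0 = - center] towards 0 at constant norm, which yields the upper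
    bound on the liminf. *)
Lemma orbit_small (e : K) : 0 < e -> exists n m : int,
  `|xi n m| < e /\ `|xi n m * xi' n m| = `|xi 0 0 * xi' 0 0|.
Proof.
move=> e_gt0; have [/andP[u0 u1] _] := unit_bounds.
have orb k : exists n m, xi n m = (r * a - 1) ^+ k * xi 0 0 /\
    `|xi n m * xi' n m| = `|xi 0 0 * xi' 0 0|.
  elim: k => [|k [n [m [E F]]]]; first by exists 0, 0; rewrite mul1r.
  have [n' [m' [E1 E2]]] := coset_step n m; exists n', m'.
  by rewrite E1 E2 norm_mul ?conj_unit // F E exprS mulrA.
have x0 : 0 < `|xi 0 0| by rewrite normr_gt0 xi_neq0.
have e2 : 0 < e / 2 / `|xi 0 0| by rewrite !divr_gt0.
have [|k hk] := expr_small _ (r * a - 1) _ _ e2; first by rewrite ltW.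
have [n [m [E F]]] := orb k; exists n, m; split => //.
rewrite E normrM gtr0_norm ?exprn_gt0 //.
by move: hk; rewrite ler_pdivlMr // => hk; lra.
Qed.

Lemma center_norm_le : `|xi 0 0 * xi' 0 0| <=
  nu * r * ((`|V 0 0 / (2 * r ^+ 2)| + (r + 4) * h) * (`|Y 0 / (2 * r)| + (r + 4) * h)).
Proof.
have nur : 0 < nu * r by rewrite mulr_gt0 // (lt_le_trans ltr01).
have r0 : r != 0 by rewrite gt_eqF.
have rV : 0 < r^-1 <= 3^-1 by rewrite invr_gt0 rp lef_pV2 ?posrE //=.
have [w0 w1] : 0 <= w /\ w <= 1.
  have r9 : 9 <= r ^+ 2 by have := r3; nra.
  have rD : 5 * r <= r * (nu * r ^+ 2 - 4).
    by rewrite mulrC ler_pM2l //; have := nu1; nra.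
  have rD0 : 0 < r * (nu * r ^+ 2 - 4) by have := rp; lra.
  split; first by rewrite divr_ge0 ?(ltW rD0) //; have := r3; lra.
  by rewrite ler_pdivrMr //; have := rp; lra.
have yh : `|0%:~R + 2^-1 + (2 * r)^-1 - w| <= 2.
  by rewrite mulr0z invfM ler_norml; case/andP: rV => ? ?; apply/andP; split; lra.
have xh : `|xi 0 0| <= 3.
  have -> : xi 0 0 = - (2^-1 - r^-1 / 2 + r^-1 ^+ 2 - 2 * w * r^-1)
      + (2^-1 + r^-1 / 2 - w) * a.
    by rewrite /xi /center -/w mulr0z; field.
  move: rV; move: r^-1 => z /andP[z0 z1]; case/andP: ha => a0 a1.
  have : 0 <= w * z <= 1 by apply/andP; split; nra.
  have : `|(2^-1 + z / 2 - w) * a| <= 1.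
    rewrite normrM (gtr0_norm a0).
    have : `|2^-1 + z / 2 - w| <= 1 by rewrite ler_norml; apply/andP; split; lra.
    have := normr_ge0 (2^-1 + z / 2 - w); nra.
  rewrite !ler_norml => /andP[? ?] /andP[? ?]; apply/andP; split; nra.
have h1 : h <= 1 by case/andP: h01.
have [||xU xY] := cell_approx 0 0.
- by have := r3; have := h0; have := normr_ge0 (0%:~R + 2^-1 + (2 * r)^-1 - w); nra.
- by have := r3; have := h0; have := normr_ge0 (xi 0 0); nra.
have -> : `|xi 0 0 * xi' 0 0| = nu * r * (`|xi 0 0| * `|xi' 0 0 / (nu * r)|).
  rewrite !normrM normfV (gtr0_norm nur); field.
  by rewrite gt_eqF // gt_eqF // (lt_le_trans ltr01).
rewrite ler_pM2l //.
have red (z t c : K) : `|z - t| <= c -> `|z| <= `|t| + c.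
  by move=> zt; have := ler_normD t (z - t); rewrite addrC subrK; lra.
by apply: ler_pM => //; exact: red.
Qed.

(** The factor [nu r] of the norm bounds is divided by [a' - a = nu r - 2 a], which lies between
    [nu r (1 - h^2)] and [nu r]. *)
Lemma inhom_liminf_center : h < 1 ->
  ((C * (1 - kappa * h) ^+ 2)%:E <= inhom_liminf a (center r nu a) <=
  (((r - 1) ^+ 2 / (2 * r ^+ 2) + (r + 4) * h) *
   ((r + 1) / (2 * r) + (r + 4) * h) / (1 - h ^+ 2))%:E)%E.
Proof.
move=> h1; case/andP: (ha) => a0 a1.
have nur : 0 < nu * r by rewrite mulr_gt0 // (lt_le_trans ltr01).
have nr1 : r <= nu * r by rewrite ler_peMl // ltW.
have d0 : 0 < a' - a by rewrite /a'; have := r3; lra.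
have aa' : a < a' by rewrite -subr_gt0.
have C0 : 0 < C.
  have r1 : 1 < r by have := r3; lra.
  by rewrite /C !mulr_gt0 ?subr_gt0 ?invf_lt1 ?exprn_gt0 ?exprn_egt1.
have k1 : 0 < 1 - kappa * h by rewrite subr_gt0.
have B0 : 0 < B := mulr_gt0 (mulr_gt0 nur C0) (exprn_gt0 2 k1).
have X0 : 0 < `|xi 0 0 * xi' 0 0| := lt_le_trans B0 (norm_ge 0 0).
have h2 : 0 < 1 - h ^+ 2 by rewrite subr_gt0 expr_lt1 // ltW.
apply/andP; split.
  apply: le_trans (inhom_liminf_ge _ _ _ _ _ _ aa' (ltW B0) norm_ge).
  rewrite lee_fin ler_pdivlMr // /B -[leRHS]mulrA mulrC.
  by rewrite (ler_pM2r (mulr_gt0 C0 (exprn_gt0 2 k1))) /a'; lra.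
have ub := inhom_liminf_le K a a' (center r nu a) (center r nu a') _ aa' X0 orbit_small.
apply: le_trans ub _.
rewrite lee_fin ler_pdivrMr //; apply: le_trans center_norm_le _.
have -> : `|V 0 0 / (2 * r ^+ 2)| = (r - 1) ^+ 2 / (2 * r ^+ 2).
  rewrite /V mulr0z mulr0 subrr mulr0 addr0 mulNr normrN ger0_norm //.
  by apply: divr_ge0; [exact: sqr_ge0|rewrite mulr_ge0 ?sqr_ge0].
have -> : `|Y 0 / (2 * r)| = (r + 1) / (2 * r).
  by rewrite /Y mulr0z mulr0 addr0 ger0_norm // divr_ge0 ?mulr_ge0 ?addr_ge0 // ltW.
have rh : 0 < (r + 4) * h by rewrite mulr_gt0 // addr_gt0.
rewrite mulrC -[leRHS]mulrA ler_pM2l; last first.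
  apply: mulr_gt0; apply: ltr_wpDl => //; apply: divr_ge0; rewrite ?sqr_ge0 //.
  - by rewrite mulr_ge0 ?sqr_ge0.
  - by rewrite addr_ge0 // ltW.
  - by rewrite mulr_ge0 // ltW.
rewrite [leRHS]mulrC ler_pdivlMr //.
have -> : nu * r * (1 - h ^+ 2) = nu * r - r * (nu * h ^+ 2) by ring.
by rewrite Nh /a'; have := r3; lra.
Qed.

End Cosets.

(** * Passage to the limit with [h = N^(-1/2)] *)

Theorem theorem2 (K : realType) (R : nat) (hR3 : (3 <= R)%N) (hRodd : odd R)
    (alpha : nat -> K)
    (halpha : forall N, (0 < N)%N -> has_ncf (alpha N) (quot_seq R N)) :
  inhom_liminf (alpha N) (ncf_expansion (alpha N) (digit_seq N))
    @[N --> \oo] -->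
  (4^-1 * (1 - R%:R^-1) * (1 - (R%:R ^+ 2)^-1) : K)%:E.
Proof.
set r : K := R%:R; set C := 4^-1 * _ * _.
have r0 : 0 < r by rewrite ltr0n (leq_trans _ hR3).
pose h N : K := Num.sqrt N%:R^-1.
have hlim : h N @[N --> \oo] --> 0.
  rewrite -(sqrtr0 K).
  apply: (@cvg_comp _ _ _ (fun N => N%:R^-1) Num.sqrt _ (nbhs (0 : K))).
    by rewrite -(cvg_shiftS _); exact: cvg_harmonic.
  exact: sqrt_continuous.
have cst (c : K) : c @[_ --> \oo] --> c by exact: cvg_cst.
pose kappa := r ^+ 2 * (r + 4).
have khlim : kappa * h N @[N --> \oo] --> 0.
  by rewrite -(mulr0 kappa); exact: (cvgM (cst _) hlim).
have Rh : (r + 4) * h N @[N --> \oo] --> 0.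
  by rewrite -(mulr0 (r + 4)); exact: (cvgM (cst _) hlim).
have lolim : C * (1 - kappa * h N) ^+ 2 @[N --> \oo] --> C.
  have k1 : (1 - kappa * h N) @[N --> \oo] --> (1 - 0 : K).
    by apply: cvgB.
  have : C * ((1 - kappa * h N) * (1 - kappa * h N)) @[N --> \oo] -->
      C * ((1 - 0) * (1 - 0)) by apply: cvgM => //; apply: cvgM.
  by rewrite subr0 !mulr1.
have hilim : ((r - 1) ^+ 2 / (2 * r ^+ 2) + (r + 4) * h N) *
   ((r + 1) / (2 * r) + (r + 4) * h N) / (1 - h N ^+ 2) @[N --> \oo] --> C.
  (* The norm at [n = m = 0] attains the minimum in the limit, so both squeezing bounds tend to
     [C]. *)
  have -> : C = ((r - 1) ^+ 2 / (2 * r ^+ 2) + 0) * ((r + 1) / (2 * r) + 0) / (1 - 0 * 0).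
    by rewrite /C; field; rewrite gt_eqF.
  apply: cvgM; first exact: (cvgM (cvgD (cst _) Rh) (cvgD (cst _) Rh)).
  apply: cvgV; first by rewrite mulr0 subr0 oner_neq0.
  exact: (cvgB (cst 1) (cvgM hlim hlim)).
have cvgE (f : nat -> K) (l : K) :
    f N @[N --> \oo] --> l -> (f N)%:E @[N --> \oo] --> l%:E.
  by move=> fl; apply: cvg_EFin => //; exact: nearW.
apply: (squeeze_cvge _ (cvgE _ _ lolim) (cvgE _ _ hilim)).
near=> N.
have N0 : (0 < N)%N by near: N; exact: nbhs_infty_gt.
have kh1 : kappa * h N < 1 by near: N; apply: (cvgr_lt _ khlim).
have h1 : h N < 1 by near: N; apply: (cvgr_lt _ hlim).
have h0 : 0 < h N by rewrite sqrtr_gt0 invr_gt0 ltr0n.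
have Nh : N%:R * h N ^+ 2 = 1.
  by rewrite sqr_sqrtr ?invr_ge0 // mulfV // pnatr_eq0 -lt0n.
have ha := halpha _ N0.
have aq := ncf_quadratic K R N _ hR3 N0 ha.
have a01 : 0 < alpha N < 2^-1.
  by rewrite (ncf_gt0 _ _ _ _ ha) (ncf_lt_half _ _ _ _ hR3 N0 ha).
have airr : irrational (alpha N) by case: ha.
have h01 : 0 < h N <= 1 by rewrite h0 ltW.
rewrite (ncf_expansionE _ R N _ hR3 N0 ha (center r N%:R (alpha N))).
  exact: inhom_liminf_center.
exact: (centerE _ _ _ _ hR3 h01 Nh _ aq).
Unshelve. all: by end_near.
Qed.
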